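(* Let $(A,\rho,b,\lambda)\in\mathbb{R}^{m\times n}\times[0,1)\times\mathbb{R}^{2m}\times\mathbb{R}_{++}$ with $b=(y^\top,r^\top)^\top$, $y,r\in\mathbb{R}^m$. A vector $w\in\mathbb{R}^{2n}$ is an extended solution of the sGMC model, i.e. $w\in S_e$ (equivalently, $w$ is the concatenation of some primal solution $x\in S_p$ and some dual solution $z\in S_d$), if and only if for every $i\in\{1,2,\dots,2n\}$ $$c_i^\top(b-DCw)\in\begin{cases}\{\lambda\,\mathrm{sign}([w]_i)\},&\text{if }[w]_i\ne0,\\ [-\lambda,\lambda],&\text{if }[w]_i=0,\end{cases}$$ where $C=\mathrm{blkdiag}(A,\sqrt{\rho}A)$, $D=\begin{bmatrix}(1-\rho)I_m&\sqrt{\rho}I_m\\-\sqrt{\rho}I_m&I_m\end{bmatrix}$ and $c_i$ is the $i$th column of $C$.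
   Context: Here $\mathbb{R}_{++}=(0,\infty)$ and $m,n$ are positive integers. The sGMC model: for $x,z\in\mathbb{R}^n$ let $$G(x,z)=\tfrac12\|y-Ax\|_2^2+\lambda\|x\|_1-\lambda\|z\|_1-\tfrac{\rho}{2}\|Ax-Az\|_2^2+\sqrt{\rho}\,r^\top Az .$$ $S_p$ is the set of minimizers over $x$ of $\max_{z}G(x,z)$; $S_d$ is the set of minimizers over $z$ of $-\min_xG(x,z)$; $S_e\subset\mathbb{R}^{2n}$ is the set of $w=(x^\top,z^\top)^\top$ such that $(x,z)$ is a saddle point of $\min_x\max_zG$, i.e. $G(x,z')\le G(x,z)\le G(x',z)$ for all $x',z'\in\mathbb{R}^n$. *)

(* Defs.v *)
From mathcomp Require Import all_boot all_order all_algebra.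
From mathcomp Require Import all_classical all_reals ereal.

Set Implicit Arguments.
Unset Strict Implicit.
Unset Printing Implicit Defensive.

Import Order.TTheory GRing.Theory Num.Theory.

Local Open Scope classical_set_scope.
Local Open Scope ring_scope.

(* Vectors of R^k are column vectors; the library's norm on matrices is the sup
   norm, hence the explicit 1-norm and 2-norm. *)

Definition dotv (R : realType) (k : nat) (u v : 'cV[R]_k) : R :=
  (u^T *m v) 0 0.

Definition norm1 (R : realType) (k : nat) (u : 'cV[R]_k) : R :=
  \sum_(i < k) `|u i 0|.

Definition norm2 (R : realType) (k : nat) (u : 'cV[R]_k) : R :=
  Num.sqrt (\sum_(i < k) u i 0 ^+ 2).

Definition argmin (R : realType) (T : Type) (f : T -> \bar R) : set T :=
  [set x | forall x', (f x <= f x')%E].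

Definition saddle_point (R : realType) (X Z : Type) (G : X -> Z -> R)
    (x : X) (z : Z) : Prop :=
  forall x' z', G x z' <= G x z /\ G x z <= G x' z.

Definition sGMC_G (R : realType) (m n : nat) (A : 'M[R]_(m, n)) (rho : R)
    (y r : 'cV[R]_m) (lambda : R) (x z : 'cV[R]_n) : R :=
  2^-1 * norm2 (y - A *m x) ^+ 2 + lambda * norm1 x - lambda * norm1 z
  - rho / 2 * norm2 (A *m x - A *m z) ^+ 2
  + Num.sqrt rho * dotv r (A *m z).

(* The inner maximum and minimum are taken as a supremum and an infimum in the
   extended reals, so that the definitions presuppose neither attainment nor
   finiteness. *)
Definition sGMC_Sp (R : realType) (m n : nat) (A : 'M[R]_(m, n)) (rho : R)
    (y r : 'cV[R]_m) (lambda : R) : set 'cV[R]_n :=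
  argmin (fun x : 'cV[R]_n =>
    ereal_sup [set (sGMC_G A rho y r lambda x z)%:E | z in [set: 'cV[R]_n]]).

Definition sGMC_Sd (R : realType) (m n : nat) (A : 'M[R]_(m, n)) (rho : R)
    (y r : 'cV[R]_m) (lambda : R) : set 'cV[R]_n :=
  argmin (fun z : 'cV[R]_n =>
    (- ereal_inf
       [set (sGMC_G A rho y r lambda x z)%:E | x in [set: 'cV[R]_n]])%E).

Definition sGMC_Se (R : realType) (m n : nat) (A : 'M[R]_(m, n)) (rho : R)
    (y r : 'cV[R]_m) (lambda : R) : set 'cV[R]_(n + n) :=
  [set w | exists x z : 'cV[R]_n,
     w = col_mx x z /\ saddle_point (sGMC_G A rho y r lambda) x z].

Definition sGMC_C (R : realType) (m n : nat) (A : 'M[R]_(m, n)) (rho : R) :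
    'M[R]_(m + m, n + n) :=
  block_mx A 0 0 (Num.sqrt rho *: A).

Definition sGMC_D (R : realType) (m : nat) (rho : R) : 'M[R]_(m + m, m + m) :=
  block_mx (1 - rho)%:M (Num.sqrt rho)%:M (- Num.sqrt rho)%:M 1%:M.

Definition lambda_sign (R : realType) (lambda t : R) : set R :=
  if t != 0 then [set lambda * Num.sg t] else [set` `[- lambda, lambda]].

(* Main.v *)
Require Import Defs.
From mathcomp Require Import all_boot all_order all_algebra.
From mathcomp Require Import all_classical all_reals ereal.
From mathcomp Require Import topology normedtype derive.
From mathcomp Require Import ring lra.

Set Implicit Arguments.
Unset Strict Implicit.

Import Order.TTheory GRing.Theory Num.Theory.
Import numFieldNormedType.Exports.

Local Open Scope classical_set_scope.
Local Open Scope ring_scope.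

(** The componentwise condition is Fermat's rule for both players at once. For
    fixed [z], moving [x] by [d] changes [G] by the variation of
    [lambda * norm1], minus a linear form in [d], plus the quadratic
    [(1 - rho) / 2 * norm2 (A *m d) ^+ 2]; moving [z] changes [- G] in the same
    way with [rho / 2]. A point minimizes such a function exactly when the
    linear form is a subgradient of [lambda * norm1] there
    ([lasso_optimality]), and the two linear forms stacked together are
    [C^T *m (b - D *m C *m w)] ([sGMC_residual]). Hence
    [sGMC_saddle_point_iff].

    That saddle points are the pairs of a primal and a dual solution holds for
    any payoff that has at least one saddle point ([saddle_point_argmin]); for
    the payoff at hand, what must be proved is that one exists. By the first
    part this means solving the inclusion of [C^T *m (b - D *m C *m w)] in the
    subdifferential of [lambda * norm1] at [w]. Because [rho < 1], [D] is
    strongly monotone: its off-diagonal blocks cancel in [dotv v (D *m v)]. So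
    [w |-> C^T *m D *m C *m w] is cocoercive, and a forward step along it with
    a small step size is nonexpansive for the Euclidean norm. Soft thresholding
    is nonexpansive too, and clipping its values to a box keeps this property
    while making the range bounded; a nonexpansive map with bounded range has
    a fixed point ([bounded_nonexpansive_fixpoint], by minimizing the
    displacement over the box). An energy estimate bounds every fixed point
    independently of the box, so for a large box the clipping is inactive at
    the fixed point, which then solves the inclusion
    ([lasso_inclusion_solvable]). *)

(** * Euclidean inner product *)

Section Dotv.
Variable R : realType.

Lemma dotvE k (u v : 'cV[R]_k) : dotv u v = \sum_i u i 0 * v i 0.
Proof. by rewrite /dotv mxE; apply: eq_bigr => i _; rewrite mxE. Qed.

Lemma dotvC k (u v : 'cV[R]_k) : dotv u v = dotv v u.
Proof. by rewrite !dotvE; apply: eq_bigr => i _; rewrite mulrC. Qed.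

Lemma dotvDl k (u v w : 'cV[R]_k) : dotv (u + v) w = dotv u w + dotv v w.
Proof. by rewrite /dotv linearD mulmxDl mxE. Qed.

Lemma dotvDr k (u v w : 'cV[R]_k) : dotv w (u + v) = dotv w u + dotv w v.
Proof. by rewrite /dotv mulmxDr mxE. Qed.

Lemma dotvZl k a (u v : 'cV[R]_k) : dotv (a *: u) v = a * dotv u v.
Proof. by rewrite /dotv linearZ -scalemxAl mxE. Qed.

Lemma dotvZr k a (u v : 'cV[R]_k) : dotv u (a *: v) = a * dotv u v.
Proof. by rewrite dotvC dotvZl dotvC. Qed.

Lemma dotvNl k (u v : 'cV[R]_k) : dotv (- u) v = - dotv u v.
Proof. by rewrite -scaleN1r dotvZl mulN1r. Qed.

Lemma dotvNr k (u v : 'cV[R]_k) : dotv u (- v) = - dotv u v.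
Proof. by rewrite dotvC dotvNl dotvC. Qed.

Definition dotv_lin := (dotvDl, dotvDr, dotvNl, dotvNr, dotvZl, dotvZr).

Lemma dotv_col_mx k l (u u' : 'cV[R]_k) (v v' : 'cV[R]_l) :
  dotv (col_mx u v) (col_mx u' v') = dotv u u' + dotv v v'.
Proof. by rewrite /dotv tr_col_mx mul_row_col mxE. Qed.

Lemma dotv_adj k l (A : 'M[R]_(k, l)) u v :
  dotv u (A *m v) = dotv (A^T *m u) v.
Proof. by rewrite /dotv trmx_mul trmxK mulmxA. Qed.

Lemma dotv_col k l (A : 'M[R]_(k, l)) i v : dotv (col i A) v = (A^T *m v) i 0.
Proof. by rewrite dotvE mxE; apply: eq_bigr => j _; rewrite !mxE. Qed.

Lemma dotv_ge0 k (u : 'cV[R]_k) : 0 <= dotv u u.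
Proof. by rewrite dotvE sumr_ge0// => i _; rewrite -expr2 sqr_ge0. Qed.

Lemma dotv_eq0 k (u : 'cV[R]_k) : dotv u u <= 0 -> u = 0.
Proof.
move=> u0; apply/colP => i; rewrite mxE; apply/eqP.
rewrite -sqrf_eq0 -[_ == _]andbT eq_le sqr_ge0 !andbT (le_trans _ u0)//.
rewrite dotvE (bigD1 i)//= expr2 lerDl sumr_ge0// => j _.
by rewrite -expr2 sqr_ge0.
Qed.

Lemma norm2_sqr k (u : 'cV[R]_k) : norm2 u ^+ 2 = dotv u u.
Proof.
rewrite /norm2 dotvE sqr_sqrtr; first by apply: eq_bigr => i _; rewrite expr2.
by apply: sumr_ge0 => i _; exact: sqr_ge0.
Qed.

Lemma dotv_sum_sqr k (u : 'cV[R]_k) : dotv u u = \sum_i u i 0 ^+ 2.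
Proof. by rewrite dotvE; apply: eq_bigr => i _; rewrite expr2. Qed.

Lemma dotv_CauchySchwarz k (u v : 'cV[R]_k) :
  dotv u v ^+ 2 <= dotv u u * dotv v v.
Proof.
have [v0|v0] := leP (dotv v v) 0.
  rewrite (dotv_eq0 v0) -(scale0r 0) !dotvZr !mul0r expr0n /=.
  by rewrite mulr0.
have := dotv_ge0 (dotv v v *: u - dotv u v *: v).
rewrite !dotv_lin (dotvC v u) => h.
rewrite -(ler_pM2l v0); nra.
Qed.

(** Cauchy-Schwarz on each row; the constant is the squared Frobenius norm. *)
Lemma mulmx_dotv_bounded k l (A : 'M[R]_(k, l)) :
  exists2 K, 0 <= K & forall v, dotv (A *m v) (A *m v) <= K * dotv v v.
Proof.
exists (\sum_i dotv (row i A)^T (row i A)^T).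
  by apply: sumr_ge0 => i _; exact: dotv_ge0.
move=> v; rewrite [leLHS]dotv_sum_sqr mulr_suml; apply: ler_sum => i _.
have -> : (A *m v) i 0 = dotv (row i A)^T v.
  by rewrite /dotv trmxK -row_mul [RHS]mxE.
exact: dotv_CauchySchwarz.
Qed.

End Dotv.

(** * Fixed points of nonexpansive maps *)

Section FixedPoint.
Variables (R : realType) (k : nat).
Implicit Types (f : 'cV[R]_k -> 'cV[R]_k) (u v : 'cV[R]_k).

Definition nonexpansive f :=
  forall u v, dotv (f u - f v) (f u - f v) <= dotv (u - v) (u - v).

Definition residual f u := dotv (u - f u) (u - f u).

Lemma continuous_sum_sqrB (T : topologicalType) (I : finType)
    (F G : I -> T -> R) :
  (forall i, continuous (F i)) -> (forall i, continuous (G i)) ->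
  continuous (fun t => \sum_i (F i t - G i t) ^+ 2).
Proof.
move=> Fc Gc; apply: continuous_big; first exact: add_continuous.
by move=> i _ t; apply: cvgM; apply: cvgB; by [exact: Fc|exact: Gc].
Qed.

(** Nonexpansiveness is measured by [dotv], while the topology of matrices comes
    from the sup norm; the two meet in the continuity of the polynomial
    [v |-> dotv (v0 - v) (v0 - v)]. *)
Lemma nonexpansive_coord_continuous f i :
  nonexpansive f -> continuous (fun v : 'rV[R]_k => f v^T i 0).
Proof.
move=> fN v0; apply/(@cvgrPdist_lt _ _ _ (nbhs v0)) => e e0.
have cD : continuous (fun v : 'rV[R]_k => \sum_j (v0 0 j - v 0 j) ^+ 2).
  apply: (@continuous_sum_sqrB _ _ (fun j _ => v0 0 j)) => j.
    exact: cst_continuous.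
  exact: coord_continuous.
have : nbhs v0 [set v : 'rV[R]_k | \sum_j (v0 0 j - v 0 j) ^+ 2 < e ^+ 2].
  have := cD v0; rewrite /continuous_at big1; last first.
    by move=> j _; rewrite subrr expr0n.
  by move=> /(@cvgr_lt _ _ (nbhs v0)); apply; rewrite exprn_gt0.
apply: filterS => v vlt.
rewrite -(ltr_pXn2r (n := 2)) ?nnegrE ?normr_ge0 ?(ltW e0)//.
rewrite real_normK ?num_real//; apply: le_lt_trans vlt.
have -> : \sum_j (v0 0 j - v 0 j) ^+ 2 = dotv (v0^T - v^T) (v0^T - v^T).
  by rewrite dotv_sum_sqr; apply: eq_bigr => j _; rewrite !mxE.
apply: le_trans (fN _ _); rewrite dotv_sum_sqr (bigD1 i)//= !mxE.
by rewrite lerDl sumr_ge0// => j _; rewrite sqr_ge0.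
Qed.

(** Weierstrass' theorem on the box of radius [M], read through transposition
    since the compactness results concern row vectors. *)
Lemma residual_argmin f (M : R) : 0 <= M -> nonexpansive f ->
  exists u, forall v, (forall i, `|v i 0| <= M) -> residual f u <= residual f v.
Proof.
move=> M0 fN.
pose B := [set v : 'rV[R]_k | forall i, [set` `[- M, M]] (v ord0 i)].
have Bc : compact B by apply: (@rV_compact _ _ (fun=> [set` `[- M, M]])) => _;
  exact: segment_compact.
have B0 : B !=set0.
  by exists 0 => i /=; rewrite mxE in_itv /= M0 oppr_le0 M0.
have rc : continuous (fun v : 'rV[R]_k => residual f v^T).
  have -> : (fun v : 'rV[R]_k => residual f v^T) =
            (fun v : 'rV[R]_k => \sum_i (v 0 i - f v^T i 0) ^+ 2).
    apply/funext => v; rewrite /residual dotv_sum_sqr.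
    by apply: eq_bigr => i _; rewrite !mxE.
  apply: continuous_sum_sqrB => i; first exact: coord_continuous.
  exact: nonexpansive_coord_continuous.
have [c _ cmin] := EVT_min_rV B0 Bc (continuous_subspaceT rc).
exists c^T => v vM; rewrite -[v]trmxK; apply: cmin; rewrite inE => i /=.
by rewrite mxE in_itv /= -ler_norml.
Qed.

(** At a minimizer [u] of the displacement, passing to [f u], which lies in the
    box, would shrink the displacement by the factor [c], so it is zero. *)
Lemma bounded_contraction_fixpoint f (M c : R) : 0 <= M -> c < 1 ->
  (forall u i, `|f u i 0| <= M) ->
  (forall u v, dotv (f u - f v) (f u - f v) <= c * dotv (u - v) (u - v)) ->
  exists u, f u = u.
Proof.
move=> M0 c1 fM fc.
have fN : nonexpansive f.
  by move=> u v; apply: le_trans (fc u v) _; rewrite ler_piMl ?dotv_ge0// ltW.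
have [u umin] := residual_argmin M0 fN; exists u.
suff : u - f u = 0 by move/subr0_eq.
apply: dotv_eq0; have := fc u (f u).
have := umin (f u) (fM u); rewrite /residual => h1 h2.
have := dotv_ge0 (u - f u); nra.
Qed.

(** The contraction [(1 - e) *: f] has a fixed point [v] in the box, and there
    [v - f v = - e *: f v], which is of order [e]. Thus the minimal displacement
    of [f] over the box is below every positive number. *)
Lemma bounded_nonexpansive_fixpoint f (M : R) : 0 <= M ->
  (forall u i, `|f u i 0| <= M) -> nonexpansive f -> exists u, f u = u.
Proof.
move=> M0 fM fN.
have [u umin] := residual_argmin M0 fN; exists u.
suff : u - f u = 0 by move/subr0_eq.
have resle e : 0 < e < 1 -> residual f u <= e ^+ 2 * (k%:R * M ^+ 2).
  move=> /andP[e0 e1].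
  have [] := @bounded_contraction_fixpoint (fun v => (1 - e) *: f v) M
    ((1 - e) ^+ 2) M0.
  - nra.
  - move=> v i; rewrite mxE normrM ger0_norm; last lra.
    by apply: le_trans (fM v i); rewrite ler_piMl ?normr_ge0//; lra.
  - move=> v w; rewrite -scalerBr dotvZl dotvZr mulrA -expr2.
    by apply: ler_wpM2l; [exact: sqr_ge0|exact: fN].
  move=> v vE; have vM i : `|v i 0| <= M.
    rewrite -vE mxE normrM ger0_norm; last lra.
    by apply: le_trans (fM v i); rewrite ler_piMl ?normr_ge0//; lra.
  apply: le_trans (umin v vM) _; rewrite /residual.
  have -> : v - f v = - e *: f v.
    by rewrite -{1}vE scalerBl scale1r scaleNr addrC addKr.
  rewrite dotvZl dotvZr mulrA mulrNN -expr2.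
  apply: ler_wpM2l; first exact: sqr_ge0.
  rewrite dotv_sum_sqr -[k in k%:R]card_ord mulr_natl -sumr_const.
  apply: ler_sum => i _; rewrite -(@real_normK _ (f v i 0)) ?num_real//.
  by rewrite ler_pXn2r ?nnegrE ?normr_ge0.
apply: dotv_eq0; rewrite -/(residual f u).
have res0 : 0 <= residual f u := dotv_ge0 _.
rewrite leNgt; apply/negP => resp.
set X := residual f u in resle resp; set Y := k%:R * M ^+ 2 in resle.
have Y0 : 0 <= Y by rewrite mulr_ge0// sqr_ge0.
(* This e is so small that X <= e ^+ 2 * Y fails: e < 1 and e * Y < X. *)
pose e := X / (X + Y + 1).
have d0 : 0 < X + Y + 1 by lra.
have e01 : 0 < e < 1 by rewrite divr_gt0//= ltr_pdivrMr//; lra.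
have eX : e * (X + Y + 1) = X by rewrite /e mulfVK// gt_eqF.
have := resle e e01; move/andP: e01 => [e0 e1].
move=> h; have := mulr_gt0 e0 resp; nra.
Qed.

End FixedPoint.

(** * Subgradients of the absolute value and of the 1-norm *)

Section Subgradient.
Variable R : realType.
Implicit Types (l a g s t c : R).

(** [lambda_sign l a] is the subdifferential of [l * `|_|] at [a]. *)
Lemma lambda_signP l a g : 0 <= l ->
  lambda_sign l a g <-> forall t, l * `|a| + g * t <= l * `|a + t|.
Proof.
move=> l0; rewrite /lambda_sign; case: ifPn => [a0|/negPn/eqP ->]; split.
- move=> /= -> t; rewrite -mulrA -mulrDr; apply: ler_wpM2l => //.
  rewrite normrEsg -mulrDr; apply: le_trans (ler_norm _) _.
  by rewrite normrM normr_sg a0 mul1r.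
(* Scaling a by 2 and by 0 turns the subgradient inequality into an equality. *)
- move=> h /=; have /(_ a) := h; have /(_ (- a)) := h.
  rewrite subrr normr0 -mulr2n normrMn => h1 h2.
  have E : g * a = l * `|a| by lra.
  by apply: (mulIf a0); rewrite E -mulrA -normrEsg.
- rewrite /= in_itv /= => /andP[h1 h2] t; rewrite normr0 add0r.
  by case: (ger0P t) => t0; nra.
- move=> h; have := h 1; have := h (-1).
  by rewrite /= in_itv /= !add0r normrN normr0 normr1; lra.
Qed.

Lemma ge0_of_affine (x c : R) : 0 <= c ->
  (forall t, 0 < t <= 1 -> 0 <= x + c * t) -> 0 <= x.
Proof.
move=> c0 h; rewrite leNgt; apply/negP => x0.
have d0 : 0 < c - x + 1 by lra.
pose t := - x / (c - x + 1).
have tE : t * (c - x + 1) = - x by rewrite /t mulfVK// gt_eqF.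
have t01 : 0 < t <= 1.
  by rewrite /t divr_gt0 ?oppr_gt0//= ler_pdivrMr// mul1r; lra.
have := mulr_ge0 (h t t01) (ltW d0).
have -> : (x + c * t) * (c - x + 1) = x * (1 - x).
  by rewrite mulrDl -(mulrA c) tE; ring.
by nra.
Qed.

(** By convexity, replacing [t] by [e * t] scales the first-order part at most
    by [e] but the quadratic term by [e ^+ 2]; letting [e] tend to 0 removes the
    latter. *)
Lemma lambda_sign_of_quadratic l a g c : 0 <= l -> 0 <= c ->
  (forall t, l * `|a| + g * t <= l * `|a + t| + c * t ^+ 2) ->
  lambda_sign l a g.
Proof.
move=> l0 c0 h; apply/lambda_signP => // t; rewrite -subr_ge0.
apply: (@ge0_of_affine _ (c * t ^+ 2)); first by rewrite mulr_ge0 ?sqr_ge0.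
move=> e /andP[e0 e1]; have := h (e * t).
have : `|a + e * t| <= (1 - e) * `|a| + e * `|a + t|.
  rewrite (_ : a + e * t = (1 - e) * a + e * (a + t)); last by ring.
  apply: le_trans (ler_normD _ _) _.
  by rewrite !normrM (gtr0_norm e0) ger0_norm ?subr_ge0.
move=> /(ler_wpM2l l0) h1 h2; rewrite -(pmulr_rge0 _ e0); nra.
Qed.

Lemma lambda_signZ c l a g : 0 < c ->
  lambda_sign (c * l) a (c * g) -> lambda_sign l a g.
Proof.
move=> c0; rewrite /lambda_sign; case: ifPn => _ /=.
  by rewrite -mulrA => /(mulfI (lt0r_neq0 c0)).
by rewrite !in_itv /= -mulrN !ler_pM2l.
Qed.

End Subgradient.

Section Lasso.
Variables (R : realType) (k p : nat).

Lemma norm1D_delta (u : 'cV[R]_k) (i : 'I_k) t :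
  norm1 (u + t *: delta_mx i 0) - norm1 u = `|u i 0 + t| - `|u i 0|.
Proof.
rewrite /norm1 (bigD1 i)//= [X in _ - X](bigD1 i)//=.
rewrite [X in _ + X - _](eq_bigr (fun j => `|u j 0|)); last first.
  by move=> j ji; rewrite !mxE (negPf ji) mulr0 addr0.
by rewrite !mxE !eqxx mulr1; ring.
Qed.

(** Fermat's rule for [l * norm1] plus a convex quadratic whose gradient at [u]
    is [- g]: necessity comes from coordinate directions alone, because the
    1-norm is separable. *)
Lemma lasso_optimality (B : 'M[R]_(p, k)) (g u : 'cV[R]_k) (l c : R) :
  0 <= l -> 0 <= c ->
  (forall d, l * norm1 u + dotv g d <=
             l * norm1 (u + d) + c * dotv (B *m d) (B *m d)) <->
  (forall i, lambda_sign l (u i 0) (g i 0)).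
Proof.
move=> l0 c0; split=> [h i|h d].
- pose e : 'cV[R]_k := delta_mx i 0.
  apply: (@lambda_sign_of_quadratic _ _ _ _ (c * dotv (B *m e) (B *m e))) => //.
    by rewrite mulr_ge0// dotv_ge0.
  move=> t; have := h (t *: e); have := norm1D_delta u i t; rewrite -/e.
  have -> : dotv g (t *: e) = g i 0 * t.
    rewrite dotvZr dotvC /dotv trmx_delta -rowE mxE; ring.
  rewrite -scalemxAr dotvZl dotvZr => h1 h2; nra.
- rewrite -[leLHS]addr0; apply: lerD; last by rewrite mulr_ge0// dotv_ge0.
  rewrite /norm1 dotvE !mulr_sumr -big_split; apply: ler_sum => i _ /=.
  by rewrite mxE; exact: (lambda_signP _ _ l0).1.
Qed.

End Lasso.

(** * Clipped soft thresholding *)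

Section ClippedShrinkage.
Variable R : realType.
Implicit Types (M c s t : R).

Definition clip M t := Num.max (- M) (Num.min M t).

Definition soft_threshold c t := t - clip c t.

Lemma clipP M t : 0 <= M ->
  [\/ t <= - M /\ clip M t = - M, - M <= t <= M /\ clip M t = t
    | M <= t /\ clip M t = M].
Proof.
move=> M0; rewrite /clip; have NM : - M <= M by lra.
case: (leP M t) => Mt; first by constructor 3; rewrite max_r.
case: (leP (- M) t) => NMt; first by constructor 2; rewrite ltW.
by constructor 1; rewrite (ltW NMt).
Qed.

Lemma clip_bound M t : 0 <= M -> `|clip M t| <= M.
Proof.
move=> M0; rewrite ler_norml; apply/andP.
by case: (clipP t M0) => -[h ->]; move: h; lra.
Qed.

Lemma clip_increment M s t : 0 <= M -> s <= t ->
  0 <= clip M t - clip M s <= t - s.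
Proof.
move=> M0 st; apply/andP.
by case: (clipP t M0) => -[ht ->]; case: (clipP s M0) => -[hs ->];
  move: ht hs; lra.
Qed.

Lemma clipped_shrinkage_lipschitz M c s t : 0 <= M -> 0 <= c ->
  (clip M (soft_threshold c t) - clip M (soft_threshold c s)) ^+ 2
    <= (t - s) ^+ 2.
Proof.
move=> M0 c0; wlog st : s t / s <= t.
  move=> h; have [/h//|/ltW/h] := leP s t.
  by rewrite -sqrrN opprB -(sqrrN (s - t)) opprB.
have /andP[h1 h2] := clip_increment c0 st.
have h3 : soft_threshold c s <= soft_threshold c t.
  by rewrite /soft_threshold; lra.
have := clip_increment M0 h3; move: h3.
rewrite /soft_threshold => h3 /andP[h4 h5].
by rewrite ler_pXn2r ?nnegrE//; lra.
Qed.

(** The clipped shrinkage is the proximal map of [c * `|_|] restricted to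
    [[-M, M]]; this is its variational inequality tested against 0, which drives
    the energy estimate. *)
Lemma clipped_shrinkage_variational M c t : 0 <= M -> 0 <= c ->
  let q := clip M (soft_threshold c t) in c * `|q| <= (t - q) * q.
Proof.
move=> M0 c0; rewrite /= /soft_threshold.
case: (clipP (t - clip c t) M0) => -[+ ->]; case: (clipP t c0) => -[ht ->];
  move: ht; case: ger0P => h0 ht hs; nra.
Qed.

(** Where the outer clipping is inactive only the proximal map of [c * `|_|]
    remains, so its displacement is a subgradient. *)
Lemma clipped_shrinkage_interior M c t : 0 <= M -> 0 <= c ->
  let q := clip M (soft_threshold c t) in `|q| < M -> lambda_sign c q (t - q).
Proof.
move=> M0 c0 /= qM; set q := clip _ _ in qM *.
have qE : q = soft_threshold c t.
  move: qM; rewrite {}/q; case: (clipP (soft_threshold c t) M0) => -[h ->] //.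
    by rewrite normrN ger0_norm ?ltxx.
  by rewrite ger0_norm ?ltxx.
rewrite {}qE /soft_threshold subKr; apply/(lambda_signP _ _ c0) => s.
case: (clipP t c0) => -[ht ->]; move: ht;
  case: ger0P => ?; case: ger0P => ? ht; nra.
Qed.

End ClippedShrinkage.

(** * Solvability of strongly monotone inclusions *)

Section StronglyMonotoneInclusion.
Variables (R : realType) (k p : nat).

(** The solution is a fixed point of the clipped forward-backward map [f]. The
    step size [tau] makes the forward step nonexpansive: for [N] the squared
    norm of [C *m d], the decrease [2 * tau * al * N] dominates the increase
    [tau ^+ 2 * K * N]. The radius [M] exceeds the energy bound by 1. *)
Lemma lasso_inclusion_solvable (C : 'M[R]_(p, k)) (D : 'M[R]_p)
    (b : 'cV[R]_p) (l al : R) :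
  0 < l -> 0 < al -> (forall v, al * dotv v v <= dotv v (D *m v)) ->
  exists w : 'cV[R]_k, forall i,
    lambda_sign l (w i 0) (dotv (col i C) (b - D *m C *m w)).
Proof.
move=> l0 al0 Dal.
pose h w := C^T *m (b - D *m C *m w).
have [K K0 Kb] := mulmx_dotv_bounded (C^T *m D).
pose tau := al / (K + 1).
have K1 : 0 < K + 1 by lra.
have tau0 : 0 < tau by rewrite divr_gt0.
have tauE : tau * (K + 1) = al by rewrite /tau mulfVK// gt_eqF.
pose M := dotv b b / (4 * al * l) + 1.
have bb0 := dotv_ge0 b.
have M1 : 1 <= M by rewrite lerDr divr_ge0// ltW// !mulr_gt0.
have M0 : 0 <= M by lra.
have ltau0 : 0 <= tau * l by rewrite mulr_ge0// ltW.
pose f (w : 'cV[R]_k) : 'cV[R]_k :=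
  \col_i clip M (soft_threshold (tau * l) (w i 0 + tau * h w i 0)).
have fM w i : `|f w i 0| <= M by rewrite mxE clip_bound.
have fN : nonexpansive f.
  move=> u v; pose F := C^T *m D *m (C *m (u - v)).
  have step : dotv (f u - f v) (f u - f v) <=
      dotv (u - v - tau *: F) (u - v - tau *: F).
    rewrite !dotv_sum_sqr; apply: ler_sum => i _.
    have -> : (u - v - tau *: F) i 0 =
        u i 0 + tau * h u i 0 - (v i 0 + tau * h v i 0).
      have -> : F = h v - h u.
        rewrite /F /h -mulmxBr opprB [b - _ + _]addrC addrA subrK -mulmxBr.
        by rewrite !mulmxA.
      by rewrite !mxE; ring.
    by rewrite !mxE; exact: clipped_shrinkage_lipschitz.
  apply: le_trans step _.
  have := Kb (C *m (u - v)); rewrite -/F.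
  have := Dal (C *m (u - v)).
  have -> : dotv (C *m (u - v)) (D *m (C *m (u - v))) = dotv (u - v) F.
    by rewrite dotvC dotv_adj dotvC mulmxA.
  have := dotv_ge0 (C *m (u - v)); set N := dotv (C *m _) _ => N0 h1 h2.
  rewrite [leLHS](_ : _ = dotv (u - v) (u - v) - tau * (2 * dotv (u - v) F -
    tau * dotv F F)); last first.
    by move: (u - v) => d; rewrite !dotv_lin (dotvC F); ring.
  rewrite gerBl mulr_ge0 ?(ltW tau0)// subr_ge0.
  have : tau * dotv F F <= tau * (K * N) by rewrite ler_wpM2l ?(ltW tau0).
  nra.
have [w wE] := bounded_nonexpansive_fixpoint M0 fM fN.
have wiE i : w i 0 = clip M (soft_threshold (tau * l) (w i 0 + tau * h w i 0)).
  by rewrite -[in LHS]wE mxE.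
(* Energy estimate: pairing the inclusion with w gives
   l * norm1 w <= dotv b v - al * dotv v v for v = C *m w, and the right-hand
   side is at most dotv b b / (4 * al) by completing the square. *)
have l1w : l * norm1 w <= dotv b b / (4 * al).
  have le1 : l * norm1 w <= dotv (h w) w.
    rewrite /norm1 dotvE mulr_sumr; apply: ler_sum => i _.
    have := clipped_shrinkage_variational (w i 0 + tau * h w i 0) M0 ltau0.
    rewrite /= -wiE -(ler_pM2l tau0); lra.
  apply: le_trans le1 _.
  have -> : dotv (h w) w = dotv b (C *m w) - dotv (C *m w) (D *m (C *m w)).
    by rewrite /h -dotv_adj dotvDl dotvNl -mulmxA (dotvC (D *m _)).
  set v := C *m w.
  have : 0 <= dotv (b - (2 * al) *: v) (b - (2 * al) *: v) by exact: dotv_ge0.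
  rewrite !dotv_lin (dotvC v b) ler_pdivlMr ?mulr_gt0// => sq.
  have := Dal v; nra.
(* The box was chosen larger than this bound, so the clipping is inactive. *)
have wM i : `|w i 0| < M.
  have : l * `|w i 0| <= dotv b b / (4 * al).
    apply: le_trans l1w; rewrite ler_pM2l// /norm1 (bigD1 i)//= lerDl.
    by apply: sumr_ge0.
  rewrite mulrC -ler_pdivlMr// => /le_lt_trans; apply.
  by rewrite /M (invfM (4 * al)) mulrA ltrDl.
exists w => i; rewrite dotv_col; apply: (lambda_signZ tau0).
have := @clipped_shrinkage_interior _ M (tau * l) (w i 0 + tau * h w i 0)
  M0 ltau0.
by rewrite /= -wiE addrC addKr; apply.
Qed.

End StronglyMonotoneInclusion.

(** * Saddle points and extremal values *)

Section SaddlePoint.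
Variables (R : realType) (X Z : Type) (G : X -> Z -> R).

(** One saddle point gives the game a value [G x0 z0], attained as both the
    minimal supremum and the maximal infimum. Any two optimal strategies are
    then squeezed against that value and form a saddle point themselves;
    without a saddle point the optimal sets could be nonempty but separated by
    a duality gap. *)
Lemma saddle_point_argmin x0 z0 : saddle_point G x0 z0 -> forall x z,
  saddle_point G x z <->
  argmin (fun x => ereal_sup [set (G x z)%:E | z in [set: Z]]) x /\
  argmin (fun z => (- ereal_inf [set (G x z)%:E | x in [set: X]])%E) z.
Proof.
have sup_le x z : saddle_point G x z ->
    (ereal_sup [set (G x z')%:E | z' in [set: Z]] <= (G x z)%:E)%E.
  move=> s; apply: ge_ereal_sup => _ [z' _ <-].
  by rewrite lee_fin; exact: (s x z').1.
have inf_ge x z : saddle_point G x z ->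
    ((G x z)%:E <= ereal_inf [set (G x' z)%:E | x' in [set: X]])%E.
  move=> s; apply: le_ereal_inf_tmp => _ [x' _ <-].
  by rewrite lee_fin; exact: (s x' z).2.
have le_sup x z :
    ((G x z)%:E <= ereal_sup [set (G x z')%:E | z' in [set: Z]])%E.
  by apply: ereal_sup_ubound; exists z.
have inf_le x z :
    (ereal_inf [set (G x' z)%:E | x' in [set: X]] <= (G x z)%:E)%E.
  by apply: ereal_inf_lbound; exists x.
move=> s0 x z; split=> [s|[xmin zmin] x' z'].
  split=> [x'|z'].
    apply: le_trans (sup_le _ _ s) (le_trans _ (le_sup x' z)).
    by rewrite lee_fin; exact: (s x' z).2.
  rewrite leeN2; apply: le_trans (inf_le x z') (le_trans _ (inf_ge _ _ s)).
  by rewrite lee_fin; exact: (s x z').1.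
have xle t : G x t <= G x0 z0.
  rewrite -lee_fin.
  exact: le_trans (le_sup x t) (le_trans (xmin x0) (sup_le _ _ s0)).
have lez t : G x0 z0 <= G t z.
  have := zmin z0; rewrite leeN2 -lee_fin => zz.
  exact: le_trans (inf_ge _ _ s0) (le_trans zz (inf_le t z)).
by split; [exact: le_trans (xle z') (lez x)|exact: le_trans (xle z) (lez x')].
Qed.

End SaddlePoint.

(** * The sGMC payoff *)

Section SGMC.
Variables (R : realType) (m n : nat) (A : 'M[R]_(m, n)) (rho l : R).
Variables (y r : 'cV[R]_m).
Hypothesis rho01 : 0 <= rho < 1.

Let G := sGMC_G A rho y r l.
Let s := Num.sqrt rho.

Let sE : s * s = rho.
Proof. by rewrite -expr2 sqr_sqrtr//; case/andP: rho01. Qed.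

Definition sGMC_primal_residual (x z : 'cV[R]_n) : 'cV[R]_n :=
  A^T *m (y - (1 - rho) *: (A *m x) - rho *: (A *m z)).

Definition sGMC_dual_residual (x z : 'cV[R]_n) : 'cV[R]_n :=
  A^T *m (s *: r + rho *: (A *m x) - rho *: (A *m z)).

Lemma sGMC_G_primal_step x z d : G (x + d) z - G x z =
  l * norm1 (x + d) - l * norm1 x - dotv (sGMC_primal_residual x z) d
  + (1 - rho) / 2 * dotv (A *m d) (A *m d).
Proof.
rewrite /G /sGMC_G !norm2_sqr /sGMC_primal_residual -dotv_adj !mulmxDr.
move: (A *m x) (A *m z) (A *m d) => a c e.
by rewrite !opprD !dotv_lin (dotvC e y) (dotvC e a) (dotvC e c) (dotvC a y);
  field.
Qed.

Lemma sGMC_G_dual_step x z d : G x z - G x (z + d) =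
  l * norm1 (z + d) - l * norm1 z - dotv (sGMC_dual_residual x z) d
  + rho / 2 * dotv (A *m d) (A *m d).
Proof.
rewrite /G /sGMC_G !norm2_sqr /sGMC_dual_residual -dotv_adj !mulmxDr -/s.
move: (A *m x) (A *m z) (A *m d) => a c e.
by rewrite !opprD !dotv_lin (dotvC e a) (dotvC e c); field.
Qed.

(** The factors [s] in [C] and [D] multiply up to [rho], so the stacked residual
    is the pair of negated gradients of the smooth parts of [G] in [x] and of
    [- G] in [z]. *)
Lemma sGMC_residual x z :
  (sGMC_C A rho)^T *m
    (col_mx y r - sGMC_D m rho *m sGMC_C A rho *m col_mx x z) =
  col_mx (sGMC_primal_residual x z) (sGMC_dual_residual x z).
Proof.
rewrite -mulmxA /sGMC_C /sGMC_D !mul_block_col !mul0mx addr0 add0r -/s.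
rewrite !mul_scalar_mx scale1r -scalemxAl scalerA sE tr_block_mx !trmx0.
rewrite opp_col_mx add_col_mx mul_block_col !mul0mx addr0 add0r.
congr col_mx; first by rewrite opprD addrA.
rewrite linearZ /= -scalemxAl scalemxAr; congr (_ *m _).
by rewrite opprD scaleNr opprK !scalerDr scalerN !scalerA sE addrA.
Qed.

Lemma sGMC_saddle_point_iff x z : 0 <= l ->
  saddle_point G x z <->
  forall i, lambda_sign l (col_mx x z i 0)
    (dotv (col i (sGMC_C A rho))
      (col_mx y r - sGMC_D m rho *m sGMC_C A rho *m col_mx x z)).
Proof.
move=> l0; case/andP: rho01 => rho0 rho1.
have c1 : 0 <= (1 - rho) / 2 by lra.
have c2 : 0 <= rho / 2 by lra.
have [px xp] := lasso_optimality A (sGMC_primal_residual x z) x l0 c1.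
have [pz zp] := lasso_optimality A (sGMC_dual_residual x z) z l0 c2.
split=> [sad i|h].
  rewrite dotv_col sGMC_residual; case: (split_ordP i) => j ->.
    rewrite !col_mxEu; apply: px => d.
    have := sGMC_G_primal_step x z d; have := (sad (x + d) z).2; lra.
  rewrite !col_mxEd; apply: pz => d.
  have := sGMC_G_dual_step x z d; have := (sad x (z + d)).1; lra.
have hx d : G x z <= G (x + d) z.
  have := sGMC_G_primal_step x z d; have /xp/(_ d) : forall i,
      lambda_sign l (x i 0) (sGMC_primal_residual x z i 0).
    by move=> i; have := h (lshift n i);
      rewrite dotv_col sGMC_residual !col_mxEu.
  lra.
have hz d : G x (z + d) <= G x z.
  have := sGMC_G_dual_step x z d; have /zp/(_ d) : forall i,
      lambda_sign l (z i 0) (sGMC_dual_residual x z i 0).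
    by move=> i; have := h (rshift n i);
      rewrite dotv_col sGMC_residual !col_mxEd.
  lra.
move=> x' z'; have := hx (x' - x); have := hz (z' - z).
by rewrite !(addrC _ (_ - _)) !subrK.
Qed.

(** The off-diagonal blocks of [D] are opposite and cancel in the quadratic
    form, leaving diagonal weights [1 - rho] and [1]. *)
Lemma sGMC_D_strongly_monotone (v : 'cV[R]_(m + m)) :
  (1 - rho) * dotv v v <= dotv v (sGMC_D m rho *m v).
Proof.
case/andP: rho01 => rho0 rho1.
rewrite -[v]vsubmxK; move: (usubmx v) (dsubmx v) => a c.
rewrite /sGMC_D mul_block_col !mul_scalar_mx !dotv_col_mx !dotv_lin.
by rewrite (dotvC c a); have := dotv_ge0 c; nra.
Qed.

Lemma sGMC_saddle_point_exists : 0 < l -> exists x z, saddle_point G x z.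
Proof.
move=> l0; have al0 : 0 < 1 - rho by case/andP: rho01; lra.
have [w ww] := lasso_inclusion_solvable (sGMC_C A rho) (col_mx y r) l0 al0
  sGMC_D_strongly_monotone.
exists (usubmx w), (dsubmx w); apply/sGMC_saddle_point_iff; first exact: ltW.
by rewrite vsubmxK.
Qed.

End SGMC.

Theorem lemma1 (R : realType) (m n : nat) (hm : (0 < m)%N) (hn : (0 < n)%N)
    (A : 'M[R]_(m, n)) (rho : R) (hrho : 0 <= rho < 1)
    (b : 'cV[R]_(m + m)) (y r : 'cV[R]_m) (hb : b = col_mx y r)
    (lambda : R) (hlambda : 0 < lambda) (w : 'cV[R]_(n + n)) :
  (sGMC_Se A rho y r lambda w <->
     forall i : 'I_(n + n),
       lambda_sign lambda (w i 0)
         (dotv (col i (sGMC_C A rho))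
               (b - sGMC_D m rho *m sGMC_C A rho *m w)))
  /\
  (sGMC_Se A rho y r lambda w <->
     exists x z : 'cV[R]_n,
       [/\ sGMC_Sp A rho y r lambda x, sGMC_Sd A rho y r lambda z
         & w = col_mx x z]).
Proof.
have l0 := ltW hlambda; subst b; split.
  split=> [[x [z [-> /(sGMC_saddle_point_iff A y r hrho x z l0)]]]//|h].
  exists (usubmx w), (dsubmx w); rewrite vsubmxK; split=> //.
  by apply/(sGMC_saddle_point_iff A y r hrho _ _ l0); rewrite vsubmxK.
have [x0 [z0 s0]] := sGMC_saddle_point_exists A y r hrho hlambda.
have sE := saddle_point_argmin s0.
split=> [[x [z [-> /sE[xmin zmin]]]]|[x [z [xmin zmin ->]]]].
  by exists x, z.
by exists x, z; split=> //; apply/sE.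
Qed.
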